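(* For every real number $p\ge 1$, the numerical index of the two-dimensional real space $\ell_p^2$ satisfies \[ n(\ell_p^2)=v(J),\qquad J=\begin{pmatrix}0&1\\-1&0\end{pmatrix}, \] where $v(J)$ is the numerical radius of $J$ regarded as an operator on $\ell_p^2$.
   Context: $\ell_p^2$ denotes $\mathbb{R}^2$ with the norm $\|(x_1,x_2)\|=(|x_1|^p+|x_2|^p)^{1/p}$, and $2\times2$ real matrices are identified with linear operators on $\ell_p^2$ in the standard basis. For a real Banach space $X$ with dual $X^*$, let $\mathcal L(X)$ be the space of bounded linear operators from $X$ to itself, with the operator norm. The numerical radius of $T\in\mathcal L(X)$ is \[ v(T):=\sup\{|x^*(Tx)| : x\in X,\ x^*\in X^*,\ \|x\|=\|x^*\|=x^*(x)=1\}, \] and the numerical index of $X$ is \[ n(X):=\inf\{v(T): T\in\mathcal L(X),\ \|T\|=1\}. \] *)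

(* Defs.v *)
From HB Require Import structures.
From mathcomp Require Import all_boot all_order all_algebra.
From mathcomp Require Import all_classical all_reals all_analysis.

Set Implicit Arguments.
Unset Strict Implicit.
Unset Printing Implicit Defensive.

Import Order.TTheory GRing.Theory Num.Theory.
Import numFieldNormedType.Exports.

Local Open Scope classical_set_scope.
Local Open Scope ring_scope.

(* [sup] takes the junk value 0 on unbounded sets, so this is the operator norm
   only for continuous [T]; every use below concerns continuous [T]. *)
Definition operator_norm (R : realType) (X Y : normedModType R)
    (T : {linear X -> Y}) : R :=
  sup [set `|T x| | x in [set x : X | `|x| <= 1]].

Definition numerical_radius (R : realType) (X : completeNormedModType R)
    (T : {linear X -> X}) : R :=
  sup [set r : R | exists (x : X) (f : {linear X -> R^o}),
    [/\ continuous f, `|x| = 1, operator_norm f = 1, f x = 1 &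
        r = `|f (T x)|] ].

Definition numerical_index (R : realType) (X : completeNormedModType R) : R :=
  inf [set numerical_radius T |
    T in [set T : {linear X -> X} | continuous T /\ operator_norm T = 1]].

Definition lp2_norm (R : realType) (p : R) (x : 'cV[R]_2) : R :=
  (`|x 0 0| `^ p + `|x 1 0| `^ p) `^ p^-1.

Section lp2_norm_theory.
Context {R : realType} (p : R) (p1 : 1 <= p).
Implicit Types x y : 'cV[R]_2.

Let p_gt0 : 0 < p. Proof. exact: lt_le_trans p1. Qed.

Let p_neq0 : p != 0. Proof. by rewrite gt_eqF. Qed.

Lemma lp2_normZ (l : R) x : lp2_norm p (l *: x) = `|l| * lp2_norm p x.
Proof.
rewrite /lp2_norm !mxE !normrM !powRM// -mulrDr powRM ?addr_ge0 ?powR_ge0//.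
by rewrite -powRrM divff// powRr1.
Qed.

Lemma lp2_norm_eq0 x : lp2_norm p x = 0 -> x = 0.
Proof.
move/powR_eq0_eq0/eqP; rewrite paddr_eq0 ?powR_ge0// => /andP[/eqP x0 /eqP x1].
apply/matrixP => i j; rewrite (ord1 j) mxE; apply/normr0_eq0.
case: i => [[|[|//]]] i2.
- by rewrite -(powR_eq0_eq0 x0); congr (`|x _ _|); exact: val_inj.
- by rewrite -(powR_eq0_eq0 x1); congr (`|x _ _|); exact: val_inj.
Qed.

Let pad x (n : nat) : R :=
  match n with 0%N => x 0 0 | 1%N => x 1 0 | _ => 0 end.

Let Lnorm_pad x :
  Lnorm counting p%:E (EFin \o pad x) = (lp2_norm p x)%:E.
Proof.
rewrite Lnorm_counting//.
rewrite (nneseries_split 0 2); last by move=> k; rewrite lee_fin powR_ge0.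
rewrite ereal_series_cond eseries0 ?adde0; last first.
  by move=> [//|] [//|n _]; rewrite /pad /= normr0 powR0.
by rewrite big_mkord 2!big_ord_recr /= big_ord0 add0e -EFinD poweR_EFin.
Qed.

Lemma ler_lp2_normD x y : lp2_norm p (x + y) <= lp2_norm p x + lp2_norm p y.
Proof.
rewrite -lee_fin EFinD -!Lnorm_pad.
have -> : pad (x + y) = (pad x \+ pad y)%R.
  by apply/funext => -[|[|n]]; rewrite /= ?mxE ?addr0.
exact: minkowski_EFin.
Qed.

Lemma ler_coord_lp2_norm x i : `|x i 0| <= lp2_norm p x.
Proof.
rewrite -[leLHS](@powRr1 R)// -(divff p_neq0) powRrM /lp2_norm.
rewrite ge0_ler_powR ?nnegrE ?addr_ge0 ?powR_ge0 ?invr_ge0 ?(ltW p_gt0)//.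
case: i => [[|[|//]]] i2.
- rewrite (_ : Ordinal i2 = 0) ?lerDl ?powR_ge0//; exact: val_inj.
- rewrite (_ : Ordinal i2 = 1) ?lerDr ?powR_ge0//; exact: val_inj.
Qed.

Lemma lp2_norm_le x : lp2_norm p x <= `|x 0 0| + `|x 1 0|.
Proof.
pose e i : 'cV[R]_2 := delta_mx i 0.
have Ne i : lp2_norm p (e i) = 1.
  rewrite /lp2_norm /e !mxE; case: i => [[|[|//]]] i2 /=.
  - by rewrite !normr1 !normr0 powR0// powR1 addr0 powR1.
  - by rewrite !normr1 !normr0 powR0// powR1 add0r powR1.
have {1}-> : x = x 0 0 *: e 0 + x 1 0 *: e 1.
  apply/matrixP => i j; rewrite (ord1 j) !mxE.
  case: i => [[|[|//]]] i2 /=; rewrite ?mulr1 ?mulr0 ?addr0 ?add0r;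
    congr (x _ _); exact: val_inj.
by rewrite (le_trans (ler_lp2_normD _ _))// !lp2_normZ !Ne !mulr1.
Qed.

End lp2_norm_theory.

(* The proof of [1 <= p] is part of the type, as the norm axioms need it. *)
Definition lp2 (R : realType) (p : R) (p1 : 1 <= p) : Type := 'cV[R]_2.

HB.instance Definition _ (R : realType) (p : R) (p1 : 1 <= p) :=
  GRing.Lmodule.copy (lp2 p1) 'cV[R]_2.

HB.instance Definition _ (R : realType) (p : R) (p1 : 1 <= p) :=
  @Lmodule_isNormed.Build R (lp2 p1) (lp2_norm p)
    (ler_lp2_normD p1) (lp2_normZ p1) (@lp2_norm_eq0 R p).

Section lp2_complete.
Context {R : realType} (p : R) (p1 : 1 <= p).

Lemma lp2_normE (x : lp2 p1) : `|x| = lp2_norm p x. Proof. by []. Qed.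

Lemma lp2_complete (F : set_system (lp2 p1)) :
  ProperFilter F -> cauchy F -> cvg F.
Proof.
move=> FF Fc.
pose c (i : 'I_2) (x : lp2 p1) : R := (x : 'cV[R]_2) i 0.
have cc i : cvg (c i @ F).
  apply: cauchy_cvg; apply/cauchyP => e e0.
  have /cauchyP/(_ e e0)[x xe] := Fc.
  exists (c i x); apply: (@filterS _ F _ _ _ _ xe) => y; rewrite -!ball_normE /=.
  apply: le_lt_trans; rewrite lp2_normE.
  by have := ler_coord_lp2_norm p1 (x - y : 'cV[R]_2) i; rewrite !mxE.
pose l : lp2 p1 := \col_i lim (c i @ F).
apply/cvg_ex; exists l; apply/cvgrPdist_lt => e e0.
have e2 : 0 < e / 2 by rewrite divr_gt0.
have h i : \forall x \near F, `|lim (c i @ F) - c i x| < e / 2.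
  by have /cvgrPdist_lt/(_ _ e2) := cc i.
near=> x.
rewrite lp2_normE (le_lt_trans (lp2_norm_le p1 _))// [e]splitr.
by rewrite ltrD// !mxE; near: x; exact: h.
Unshelve. all: by end_near. Qed.

HB.instance Definition _ := Uniform_isComplete.Build (lp2 p1) lp2_complete.

End lp2_complete.

Section lp2_operator.
Context {R : realType} (p : R) (p1 : 1 <= p) (A : 'M[R]_2).

Definition lp2_operator (x : lp2 p1) : lp2 p1 := A *m (x : 'cV[R]_2).

Lemma lp2_operator_is_linear : linear lp2_operator.
Proof. by move=> a x y; rewrite /lp2_operator mulmxDr scalemxAr. Qed.

HB.instance Definition _ :=
  GRing.isLinear.Build R (lp2 p1) (lp2 p1) _ lp2_operator
    lp2_operator_is_linear.

End lp2_operator.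

Arguments lp2_operator {R p} p1 A x.

Definition matJ (R : realType) : 'M[R]_2 := delta_mx 0 1 - delta_mx 1 0.

(* Main.v *)
(* For 0 < t < 1 write P = t^(p-1) and g = t^p.  Testing T = [[a, b], [c, d]] on
   the norming pairs ((1, +-t), (1, +-P)) and ((t, +-1), (P, +-1)), suitably
   normalized, gives
     |bt + cP| + |a + dg| <= v(T) (1 + g),  |bP + ct| + |ag + d| <= v(T) (1 + g).
   With |P - t| as the right-hand sides these inequalities cut out a product of
   two l1-balls.  Its vertices are diagonal or antidiagonal with entries at most
   1 in absolute value or, up to signs and a swap of coordinates, equal to
     [[g D, t/(P+t)], [P/(P+t), D]],  D = |P - t|/(1 - g^2);
   the Schur test with the weights (1, t), (t, 1) shows that all of them are
   contractions of l_p^2.  Hence |P - t|/(1 + g) ||T|| <= v(T) for every t, while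
   v(J) is the supremum of |P - t|/(1 + g) over t. *)

Require Import Defs.
From HB Require Import structures.
From mathcomp Require Import all_boot all_order all_algebra.
From mathcomp Require Import all_classical all_reals all_analysis.
From mathcomp Require Import ring lra.

Set Implicit Arguments.
Unset Strict Implicit.
Unset Printing Implicit Defensive.

Import Order.TTheory GRing.Theory Num.Theory.
Import numFieldNormedType.Exports.

Local Open Scope classical_set_scope.
Local Open Scope ring_scope.

(** * Convexity, tangent and subgradient inequalities for real powers *)

Lemma powR_convex {R : realType} (p l x y : R) : 1 <= p -> 0 <= l <= 1 ->
  0 <= x -> 0 <= y ->
  (l * x + (1 - l) * y) `^ p <= l * x `^ p + (1 - l) * y `^ p.
Proof.
move=> p1 /andP[l0 l1] x0 y0.
by have := convex_powR p1 (Itv01 l0 l1) (x := x) (y := y);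
  rewrite !inE /= !in_itv /= !andbT => /(_ x0 y0).
Qed.

Lemma norm_powR_convex {R : realType} (p l x y : R) : 1 <= p -> 0 <= l <= 1 ->
  `|l * x + (1 - l) * y| `^ p <= l * `|x| `^ p + (1 - l) * `|y| `^ p.
Proof.
move=> p1 /[dup] l01 /andP[l0 l1].
apply: le_trans (powR_convex p1 l01 (normr_ge0 x) (normr_ge0 y)).
rewrite ge0_ler_powR ?nnegrE ?addr_ge0 ?mulr_ge0 ?subr_ge0//; first lra.
by rewrite (le_trans (ler_normD _ _))// !normrM (ger0_norm l0) (@ger0_norm _ (1 - l)) ?subr_ge0.
Qed.

(** Jensen's inequality with the missing mass [1 - (v + w)] placed at 0, where the power
    vanishes. *)
Lemma powR_subconvex {R : realType} (p v w x y : R) : 1 <= p ->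
  0 <= v -> 0 <= w -> v + w <= 1 -> 0 <= x -> 0 <= y ->
  (v * x + w * y) `^ p <= v * x `^ p + w * y `^ p.
Proof.
move=> p1 v0 w0 vw x0 y0.
have p0 : p != 0 by lra.
have [s0|s_neq0] := eqVneq (v + w) 0.
  have -> : v = 0 by lra.
  have -> : w = 0 by lra.
  by rewrite !mul0r !addr0 powR0.
have s0 : 0 < v + w by rewrite lt_neqAle eq_sym s_neq0 addr_ge0.
have l01 : 0 <= v / (v + w) <= 1.
  by rewrite divr_ge0 ?addr_ge0//= ler_pdivrMr// mul1r lerDl.
have lE : 1 - v / (v + w) = w / (v + w) by field.
have h := powR_convex p1 l01 x0 y0.
have h0 : 0 <= v + w <= 1 by rewrite addr_ge0.
have z0 : 0 <= v / (v + w) * x + (1 - v / (v + w)) * y.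
  by rewrite lE addr_ge0// mulr_ge0// divr_ge0// ltW.
have := powR_convex p1 h0 z0 (lexx 0).
rewrite powR0// !mulr0 !addr0.
have -> : (v + w) * (v / (v + w) * x + (1 - v / (v + w)) * y) = v * x + w * y.
  by rewrite lE; field.
move=> /le_trans; apply.
rewrite (le_trans (ler_wpM2l (ltW s0) h))// lE le_eqVlt; apply/orP; left.
by apply/eqP; field.
Qed.

(** For [p > 1] this is Young's inequality for the product [a * 1] with exponents [p] and
    [p / (p - 1)], multiplied by [p]. *)
Lemma powR_bernoulli {R : realType} (p a : R) : 1 <= p -> 0 <= a ->
  1 + p * (a - 1) <= a `^ p.
Proof.
rewrite le_eqVlt => /predU1P[<- a0|p1 a0]; first by rewrite powRr1//; lra.
have p0 : 0 < p by lra.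
have q0 : 0 < p / (p - 1) by rewrite divr_gt0// subr_gt0.
have pq : p^-1 + (p / (p - 1))^-1 = 1.
  by field; apply/andP; split; apply/eqP; lra.
have := conjugate_powR a0 ler01 p0 q0 pq.
rewrite powR1 mulr1 invf_div mul1r -mulrDl ler_pdivlMr//; lra.
Qed.

(** Bernoulli's inequality at [m^-1], multiplied by m^p. *)
Lemma powR_tangent {R : realType} (p m : R) : 1 <= p -> 0 < m ->
  m `^ p - 1 <= p * m `^ (p - 1) * (m - 1).
Proof.
move=> p1 m0.
have mi : 0 <= m^-1 by rewrite invr_ge0 ltW.
have := powR_bernoulli p1 mi.
rewrite -{2}[m]powRr1 ?(ltW m0)// -(powRN m 1) -powRrM mulN1r powRN.
rewrite -(ler_pM2r (powR_gt0 p m0)) mulVf ?gt_eqF ?powR_gt0//.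
have -> : m `^ p = m * m `^ (p - 1) by rewrite mulr_powRB1 ?ltW//; lra.
have -> : (1 + p * (m^-1 - 1)) * (m * m `^ (p - 1)) =
   m * m `^ (p - 1) * (1 - p) + p * m `^ (p - 1).
  by field; rewrite gt_eqF.
lra.
Qed.

(** The hypothesis makes p g a subgradient of |.|^p at [x]. Increments along [x] bound [x * g]; at
    [x = 0], small increments in the direction of [g] force [g = 0] because [p - 1 > 0]. *)
Lemma subgradient_norm_powR {R : realType} (p g x : R) : 1 < p ->
  (forall s, p * (s * g) + `|x| `^ p <= `|x + s| `^ p) ->
  x * g <= `|x| `^ p /\ (x = 0 -> g = 0).
Proof.
move=> p1 h.
have q0 : 0 < p - 1 by lra.
have root (c : R) : 0 < c -> (c `^ (p - 1)^-1) `^ (p - 1) = c.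
  by move=> c0; rewrite -powRrM mulVf ?gt_eqF// powRr1// ltW.
split.
- have [->|x0] := eqVneq x 0; first by rewrite mul0r powR_ge0.
  have B0 : 0 < `|x| `^ p by rewrite powR_gt0// normr_gt0.
  apply/ler_addgt0Pr => e e0.
  (* [c] is chosen so that c |x|^p = |x|^p + e, and [m] is its root of order [p - 1], so the slope
     in [powR_tangent] becomes p c. *)
  pose c := 1 + e / `|x| `^ p.
  have c1 : 1 < c by rewrite ltrDl divr_gt0.
  pose m := c `^ (p - 1)^-1.
  have m1 : 1 < m.
    have -> : 1 = 1 `^ (p - 1)^-1 by rewrite powR1.
    by rewrite gt0_ltr_powR ?invr_gt0// nnegrE; lra.
  have m0 : 0 < m by lra.
  have := h ((m - 1) * x).
  have -> : x + (m - 1) * x = m * x by ring.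
  rewrite normrM (gtr0_norm m0) powRM ?(ltW m0)// => {}h.
  have t := powR_tangent (ltW p1) m0.
  have {}t := ler_wpM2r (ltW B0) t.
  have mp : m `^ (p - 1) = c by rewrite root//; lra.
  rewrite mp in t.
  have {h t} : p * (m - 1) * (x * g) <= p * (m - 1) * (c * `|x| `^ p) by lra.
  rewrite ler_pM2l; last by rewrite mulr_gt0//; lra.
  by rewrite /c mulrDl mul1r divfK// gt_eqF.
- move=> x0; move: h; rewrite {}x0 normr0 powR0 ?gt_eqF//; last lra.
  move=> h; apply/normr0_eq0/eqP; rewrite eq_le normr_ge0 andbT.
  apply/ler_addgt0Pr => e e0; rewrite add0r.
  (* Now m^(p-1) = e, so the increment m sg(g) leaves p |g| <= e after division by [m]. *)
  pose m := e `^ (p - 1)^-1.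
  have m0 : 0 < m by rewrite powR_gt0.
  have := h (m * Num.sg g).
  rewrite add0r addr0 -mulrA -normrEsg normrM (gtr0_norm m0) => {}h.
  have : p * (m * `|g|) <= m * e.
    rewrite (le_trans h)// -[leRHS](_ : m `^ p = _); last first.
      by rewrite -(mulr_powRB1 (ltW m0)) ?root//; lra.
    rewrite ge0_ler_powR ?nnegrE ?mulr_ge0 ?(ltW m0)//; first lra.
    rewrite ler_piMr ?(ltW m0)//.
    by rewrite normr_sg; case: (g != 0).
  rewrite mulrCA ler_pM2l//; have := normr_ge0 g; nra.
Qed.

(** * Contractions of the plane and the Schur test *)

(** The matrix [[a, b], [c, d]] is a contraction of l_p^2. Keeping p-th powers lets convexity of
    |.|^p act on each term. *)
Definition contracts {R : realType} (p a b c d : R) : Prop := forall x y,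
  `|a * x + b * y| `^ p + `|c * x + d * y| `^ p <= `|x| `^ p + `|y| `^ p.

Lemma contracts_convex {R : realType} (p l a b c d a' b' c' d' : R) :
  1 <= p -> 0 <= l <= 1 -> contracts p a b c d -> contracts p a' b' c' d' ->
  contracts p (l * a + (1 - l) * a') (l * b + (1 - l) * b')
              (l * c + (1 - l) * c') (l * d + (1 - l) * d').
Proof.
move=> p1 /[dup] l01 /andP[l0 l1] A A' x y.
have := norm_powR_convex (a * x + b * y) (a' * x + b' * y) p1 l01.
have := norm_powR_convex (c * x + d * y) (c' * x + d' * y) p1 l01.
have {A} := ler_wpM2l l0 (A x y).
have {A'} : (1 - l) * (`|a' * x + b' * y| `^ p + `|c' * x + d' * y| `^ p) <=
            (1 - l) * (`|x| `^ p + `|y| `^ p).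
  by rewrite ler_wpM2l ?subr_ge0.
have -> : (l * a + (1 - l) * a') * x + (l * b + (1 - l) * b') * y =
  l * (a * x + b * y) + (1 - l) * (a' * x + b' * y) by ring.
have -> : (l * c + (1 - l) * c') * x + (l * d + (1 - l) * d') * y =
  l * (c * x + d * y) + (1 - l) * (c' * x + d' * y) by ring.
lra.
Qed.

Lemma contracts_swap {R : realType} (p a b c d : R) :
  contracts p a b c d -> contracts p d c b a.
Proof.
by move=> A x y; rewrite addrC (addrC (b * x)) (addrC (d * x)) (addrC (`|x| `^ p)).
Qed.

Lemma contracts_diag {R : realType} (p a d : R) : 0 <= p ->
  `|a| <= 1 -> `|d| <= 1 -> contracts p a 0 0 d.
Proof.
move=> p0 a1 d1 x y; rewrite !mul0r addr0 add0r !normrM.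
by apply: lerD; apply: ge0_ler_powR; rewrite ?nnegrE ?mulr_ge0// ler_piMl.
Qed.

Lemma contracts_antidiag {R : realType} (p b c : R) : 0 <= p ->
  `|b| <= 1 -> `|c| <= 1 -> contracts p 0 b c 0.
Proof.
move=> p0 b1 c1 x y; rewrite !mul0r addr0 add0r !normrM addrC.
by apply: lerD; apply: ge0_ler_powR; rewrite ?nnegrE ?mulr_ge0// ler_piMl.
Qed.

(** Convexity of the power with weights |a| h1 / k and |b| h2 / k, of total at most 1, at the points
    |x| / h1 and |y| / h2. *)
Lemma weighted_row_bound {R : realType} (p a b h1 h2 k x y : R) : 1 <= p ->
  0 < h1 -> 0 < h2 -> 0 < k -> `|a| * h1 + `|b| * h2 <= k ->
  `|a * x + b * y| `^ p <= k `^ (p - 1) *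
    (`|a| * (`|x| `^ p / h1 `^ (p - 1)) + `|b| * (`|y| `^ p / h2 `^ (p - 1))).
Proof.
move=> p1 h10 h20 k0 hk.
have p0 : 0 < p by lra.
have quot (h z : R) : 0 < h ->
    (`|z| / h) `^ p = `|z| `^ p / (h * h `^ (p - 1)).
  move=> h0; rewrite powRM ?invr_ge0 ?(ltW h0)//; congr (_ * _).
  by rewrite mulr_powRB1 ?(ltW h0)// -(powR_inv1 (ltW h0)) -powRrM mulN1r powRN.
have v0 : 0 <= `|a| * h1 / k by rewrite divr_ge0 ?mulr_ge0// ?(ltW h10) ?(ltW k0).
have w0 : 0 <= `|b| * h2 / k by rewrite divr_ge0 ?mulr_ge0// ?(ltW h20) ?(ltW k0).
have vw : `|a| * h1 / k + `|b| * h2 / k <= 1.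
  by rewrite -mulrDl ler_pdivrMr// mul1r.
have X0 : 0 <= `|x| / h1 by rewrite divr_ge0// ltW.
have Y0 : 0 <= `|y| / h2 by rewrite divr_ge0// ltW.
have := powR_subconvex p1 v0 w0 vw X0 Y0.
set s := _ * _ + _ * _ => hs.
have s0 : 0 <= s by rewrite addr_ge0// mulr_ge0.
have kp : 0 <= k `^ p by rewrite powR_ge0.
have {hs} := ler_wpM2l kp hs.
rewrite -powRM ?(ltW k0)// !quot// => hs.
apply: (@le_trans _ _ ((k * s) `^ p)).
  apply: ge0_ler_powR; rewrite ?nnegrE ?mulr_ge0 ?(ltW k0) ?(ltW p0)//.
  apply: le_trans (ler_normD _ _) _.
  rewrite !normrM le_eqVlt; apply/orP; left; apply/eqP; rewrite /s.
  by field; rewrite !gt_eqF.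
apply: (le_trans hs); rewrite -(mulr_powRB1 (ltW k0) p0).
rewrite le_eqVlt; apply/orP; left; apply/eqP.
by field; rewrite !gt_eqF ?powR_gt0.
Qed.

(* Schur test: the weights of each row are a subprobability vector after scaling
   by [h], so Jensen applies row by row. *)
Lemma contracts_schur {R : realType} (p a b c d h1 h2 k1 k2 : R) : 1 <= p ->
  0 < h1 -> 0 < h2 -> 0 < k1 -> 0 < k2 ->
  `|a| * h1 + `|b| * h2 <= k1 -> `|c| * h1 + `|d| * h2 <= k2 ->
  `|a| * k1 `^ (p - 1) + `|c| * k2 `^ (p - 1) <= h1 `^ (p - 1) ->
  `|b| * k1 `^ (p - 1) + `|d| * k2 `^ (p - 1) <= h2 `^ (p - 1) ->
  contracts p a b c d.
Proof.
move=> p1 h10 h20 k10 k20 row1 row2 col1 col2 x y.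
have := weighted_row_bound x y p1 h10 h20 k10 row1.
have := weighted_row_bound x y p1 h10 h20 k20 row2.
set X := `|x| `^ p / _; set Y := `|y| `^ p / _ => r2 r1.
have X0 : 0 <= X by rewrite divr_ge0 ?powR_ge0.
have Y0 : 0 <= Y by rewrite divr_ge0 ?powR_ge0.
(* The sum of the row bounds is regrouped by columns: the coefficients of [X] and [Y] are at most
   the powers of [h1] and [h2] that cancel their denominators. *)
have {col1} := ler_wpM2r X0 col1; have {col2} := ler_wpM2r Y0 col2.
rewrite /X /Y [h1 `^ _ * _]mulrC [h2 `^ _ * _]mulrC.
rewrite !divfK ?gt_eqF ?powR_gt0// -/X -/Y; lra.
Qed.

(* All four bounds follow from [d <= al^2 e], which is [be^2 (1 - al^4) >= 0]. *)
Lemma schur_weights {R : realType} (al be e d : R) :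
  0 < be -> be < al -> al <= 1 ->
  e = (al + be)^-1 -> d = (al - be) / (1 - (al * be) ^+ 2) ->
  [/\ al * be * d + be * e * be <= be, al * e + d * be <= 1,
      al * be * d * al + al * e <= 1 & be * e * al + d <= al].
Proof.
move=> be0 beal al1 eE dE.
have al0 : 0 < al by lra.
have ab0 : 0 < al * be by rewrite mulr_gt0.
have ab1 : al * be < 1 by nra.
have g1 : 0 < 1 - (al * be) ^+ 2 by rewrite expr2; nra.
have e0 : 0 < e by rewrite eE invr_gt0; lra.
have eab : e * (al + be) = 1 by rewrite eE mulVf// gt_eqF//; lra.
have dale : d <= al ^+ 2 * e.
  rewrite dE eE ler_pdivrMr// mulrAC ler_pdivlMr; last lra.
  have al4 : al ^+ 4 <= 1 by rewrite exprn_ile1// ltW.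
  have : be ^+ 2 * al ^+ 4 <= be ^+ 2 * 1 by rewrite ler_wpM2l// sqr_ge0.
  rewrite !exprMn; lra.
have al2 : al ^+ 2 <= 1 by rewrite exprn_ile1// ltW.
have de : d <= e by apply: le_trans dale _; rewrite ler_piMl// ltW.
have bd : be * d <= be * e by rewrite ler_pM2l.
have abd : al * (be * d) <= al * (be * e) by rewrite ler_pM2l.
have d0 : 0 <= d by rewrite dE divr_ge0 ?(ltW g1)// subr_ge0 ltW.
have aabd : al ^+ 2 * (be * d) <= be * d.
  by rewrite ler_piMl// mulr_ge0// ltW.
have beb : be * (e * (al + be)) = be by rewrite eab mulr1.
have alb : al * (e * (al + be)) = al by rewrite eab mulr1.
by split; lra.
Qed.

(** * Contractions inside the polytope of test inequalities *)

Lemma l1_ball_convex {R : realType} (K : R -> R -> Prop) (u r : R) :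
  (forall l x y x' y', 0 <= l <= 1 -> K x y -> K x' y' ->
     K (l * x + (1 - l) * x') (l * y + (1 - l) * y')) ->
  (forall s, `|s| = 1 -> K s 0) -> (forall s, `|s| = 1 -> K 0 s) ->
  `|u| + `|r| <= 1 -> K u r.
Proof.
move=> Kc K1 K2 ur.
have := ler_norm u; have := ler_norm (- u); rewrite normrN => ? ?.
have := ler_norm r; have := ler_norm (- r); rewrite normrN => ? ?.
(* In the coordinates u + r and u - r the l1-ball is a product of intervals: [n] fixes u - r on the
   opposite edges u + r = 1 and u + r = -1, and [m] mixes the two edge points. *)
pose m := (1 + u + r) / 2; pose n := (1 + u - r) / 2.
have m01 : 0 <= m <= 1 by rewrite /m; apply/andP; split; lra.
have n01 : 0 <= n <= 1 by rewrite /n; apply/andP; split; lra.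
have N1 : `|- 1 : R| = 1 by rewrite normrN normr1.
have := Kc m _ _ _ _ m01 (Kc n _ _ _ _ n01 (K1 1 (normr1 _)) (K2 1 (normr1 _)))
  (Kc n _ _ _ _ n01 (K2 (-1) N1) (K1 (-1) N1)).
set X := (X in K X); set Y := (Y in K _ Y).
have -> : X = u by rewrite /X /m /n; field.
by have -> : Y = r by rewrite /Y /m /n; field.
Qed.

Section polytope.
Context {R : realType} (p t : R) (p1 : 1 <= p) (t0 : 0 < t) (t1 : t < 1).
Let P := t `^ (p - 1).
Let g := P * t.
Hypothesis Pt : P != t.

Let P0 : 0 < P. Proof. exact: powR_gt0. Qed.

Let P1 : P <= 1.
Proof.
have t01 : 0 < t <= 1 by rewrite t0 ltW.
have p10 : 0 <= p - 1 by rewrite subr_ge0.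
by have := ger_powR t01 p10; rewrite powRr0.
Qed.

Let g0 : 0 < g. Proof. exact: mulr_gt0. Qed.

Let g1 : g < 1. Proof. by rewrite (le_lt_trans _ t1)// ler_piMl// ltW. Qed.

Let g2 : 0 < 1 - g ^+ 2. Proof. by rewrite subr_gt0 exprn_ilt1// ltW. Qed.

Let Pt0 : 0 < P + t. Proof. exact: addr_gt0. Qed.

(** This is the vertex [K s 0 0 z] in the notation below; neither diagonal nor antidiagonal, it
    calls for the Schur test. *)
Let mixed_vertex (s z : R) : `|s| = 1 -> `|z| = 1 ->
  contracts p ((P - t) * (- (g * z)) / (1 - g ^+ 2)) (- (t * s) / (P + t))
              (P * s / (P + t)) ((P - t) * z / (1 - g ^+ 2)).
Proof.
move=> s1 z1.
have aE : `|(P - t) * (- (g * z)) / (1 - g ^+ 2)| =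
    P * t * (`|P - t| / (1 - (P * t) ^+ 2)).
  rewrite !normrM normrN normrM z1 mulr1 (gtr0_norm g0) normfV (gtr0_norm g2).
  by rewrite /g; ring.
have bE : `|- (t * s) / (P + t)| = t * (P + t)^-1.
  by rewrite normrM normrN normrM s1 mulr1 normfV (gtr0_norm t0) (gtr0_norm Pt0).
have cE : `|P * s / (P + t)| = P * (P + t)^-1.
  by rewrite !normrM s1 mulr1 normfV (gtr0_norm P0) (gtr0_norm Pt0).
have dE : `|(P - t) * z / (1 - g ^+ 2)| = `|P - t| / (1 - (P * t) ^+ 2).
  by rewrite !normrM z1 mulr1 normfV (gtr0_norm g2).
(* The larger of [P] and [t] plays the role of [al]. Between the two cases the row and column
   conditions exchange, and so do the weights (1, t) and (t, 1). *)
have [ltPt|gtPt|eqPt] := ltgtP P t; last by move: Pt; rewrite eqPt eqxx.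
- have [||||//|w1 w2 w3 w4] := @schur_weights R t P (P + t)^-1
    (`|P - t| / (1 - (P * t) ^+ 2)) => //.
  + exact: ltW.
  + by rewrite addrC.
  + by rewrite distrC gtr0_norm ?subr_gt0// [t * P]mulrC.
  + rewrite [t * P]mulrC in w1 w3.
    by apply: (@contracts_schur _ _ _ _ _ _ t 1 1 t) => //;
      rewrite ?aE ?bE ?cE ?dE ?powR1 ?mulr1 -/P.
- have [||||//|w1 w2 w3 w4] := @schur_weights R P t (P + t)^-1
    (`|P - t| / (1 - (P * t) ^+ 2)) => //.
  + by rewrite gtr0_norm ?subr_gt0.
  + by apply: (@contracts_schur _ _ _ _ _ _ 1 t t 1) => //;
      rewrite ?aE ?bE ?cE ?dE ?powR1 ?mulr1 -/P.
Qed.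

Let corner_le1 (s z : R) : `|s| = 1 -> `|z| = 1 ->
  `|(P * s - t * z) / (P + t)| <= 1.
Proof.
move=> s1 z1; rewrite normrM normfV (gtr0_norm Pt0) ler_pdivrMr// mul1r.
rewrite (le_trans (ler_normB _ _))// !normrM s1 z1 !mulr1.
by rewrite (gtr0_norm P0) (gtr0_norm t0).
Qed.

Let diag_corner_le1 (s z : R) : `|s| = 1 -> `|z| = 1 ->
  `|(P - t) * (s - g * z) / (1 - g ^+ 2)| <= 1.
Proof.
move=> s1 z1; rewrite normrM normfV (gtr0_norm g2) ler_pdivrMr// mul1r normrM.
(* The two bounds amount to (1 - P)(1 + t) >= 0 and (1 + P)(1 - t) >= 0. *)
have d1 : `|P - t| <= 1 - g by move: P0 P1 t0 t1 => ? ? ? ?; rewrite ler_norml /g; apply/andP; split; nra.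
have e1 : `|s - g * z| <= 1 + g.
  by rewrite (le_trans (ler_normB _ _))// normrM s1 z1 mulr1 (gtr0_norm g0).
rewrite (le_trans (ler_pM _ _ d1 e1))// le_eqVlt; apply/orP; left.
by apply/eqP; ring.
Qed.

(* The matrix on which the four linear forms of [contracts_polytope], divided by
   [P - t], take the values [u], [r], [w], [s]. *)
Let K (u r w s : R) := contracts p
  ((P - t) * (r - g * s) / (1 - g ^+ 2)) ((P * w - t * u) / (P + t))
  ((P * u - t * w) / (P + t)) ((P - t) * (s - g * r) / (1 - g ^+ 2)).

Let contracts_eq (a b c d a' b' c' d' : R) : a = a' -> b = b' -> c = c' ->
  d = d' -> contracts p a b c d -> contracts p a' b' c' d'.
Proof. by move=> -> -> -> ->. Qed.

Let K_convex (l u r w s u' r' w' s' : R) : 0 <= l <= 1 ->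
  K u r w s -> K u' r' w' s' ->
  K (l * u + (1 - l) * u') (l * r + (1 - l) * r')
    (l * w + (1 - l) * w') (l * s + (1 - l) * s').
Proof.
move=> l01 A A'; apply: contracts_eq (contracts_convex p1 l01 A A'); ring.
Qed.

(** With [u], [r] at a vertex of the first ball, convexity in [w], [s] leaves the antidiagonal
    vertices, the diagonal ones, and two mixed kinds related by the swap of coordinates. *)
Let K_vertex_l (u r : R) : (`|u| = 1 /\ r = 0) \/ (u = 0 /\ `|r| = 1) ->
  forall w s, `|w| + `|s| <= 1 -> K u r w s.
Proof.
have p0 : 0 <= p := le_trans ler01 p1.
move=> ur w s; apply: (@l1_ball_convex _ (K u r)).
- move=> l x y x' y' l01 A A'.
  have := K_convex l01 A A'.
  have -> : l * u + (1 - l) * u = u by ring.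
  by have -> : l * r + (1 - l) * r = r by ring.
- move=> {w s} w w1; case: ur => -[].
  + move=> u1 ->; rewrite /K !mulr0 subrr !mulr0 !mul0r.
    by apply: contracts_antidiag => //; exact: corner_le1.
  + move=> -> r1; apply: contracts_swap.
    apply: contracts_eq (mixed_vertex w1 r1); ring.
- move=> {w s} s s1; case: ur => -[].
  + move=> u1 ->; apply: contracts_eq (mixed_vertex u1 s1); ring.
  + move=> -> r1; rewrite /K !mulr0 subrr !mul0r.
    by apply: contracts_diag => //; exact: diag_corner_le1.
Qed.

Let K_l1_balls (u r w s : R) : `|u| + `|r| <= 1 -> `|w| + `|s| <= 1 ->
  K u r w s.
Proof.
move=> ur ws; apply: (@l1_ball_convex _ (fun u r => K u r w s)) ur.
- move=> l x y x' y' l01 A A'.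
  have := K_convex l01 A A'.
  have -> : l * w + (1 - l) * w = w by ring.
  by have -> : l * s + (1 - l) * s = s by ring.
- by move=> z z1; apply: K_vertex_l => //; left.
- by move=> z z1; apply: K_vertex_l => //; right.
Qed.

(** Division by [P - t] turns the hypotheses into l1 bounds on [u], [r] and on [w], [s]; the
    formulas in [K] invert the four linear forms. *)
Lemma contracts_polytope (a b c d : R) :
  `|b * t + c * P| + `|a + d * g| <= `|P - t| ->
  `|b * P + c * t| + `|a * g + d| <= `|P - t| ->
  contracts p a b c d.
Proof.
move=> ur ws.
have Pt_neq0 : P - t != 0 by rewrite subr_eq0.
have scale (x y : R) : `|x| + `|y| <= `|P - t| ->
    `|x / (P - t)| + `|y / (P - t)| <= 1.
  move=> xy; rewrite !normrM normfV -mulrDl ler_pdivrMr ?mul1r//.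
  by rewrite normr_gt0.
have Pt_neq0' : P + t != 0 by rewrite gt_eqF.
have g2_neq0 : 1 - g ^+ 2 != 0 by rewrite gt_eqF.
by apply: contracts_eq (K_l1_balls (scale _ _ ur) (scale _ _ ws)); field;
  apply/andP.
Qed.

End polytope.

(** * Operator norms of bounded linear maps *)

Lemma operator_norm_le {R : realType} (X Y : normedModType R)
    (T : {linear X -> Y}) (k : R) :
  0 <= k -> (forall x, `|T x| <= k * `|x|) -> operator_norm T <= k.
Proof.
move=> k0 Tk; apply: ge_sup.
  by exists `|T 0|, 0; rewrite //= normr0.
move=> _ [x /= x1 <-]; apply: le_trans (Tk x) _.
by rewrite ler_piMr.
Qed.

(** Homogeneity reduces to the unit ball; the assumed bound keeps [sup] away from its default value
    0. *)
Lemma operator_norm_ge {R : realType} (X Y : normedModType R)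
    (T : {linear X -> Y}) (k : R) :
  (forall x, `|T x| <= k * `|x|) ->
  forall x, `|T x| <= operator_norm T * `|x|.
Proof.
move=> Tk x; have [->|x0] := eqVneq x 0.
  by rewrite linear0 !normr0 mulr0.
have nx0 : 0 < `|x| by rewrite normr_gt0.
rewrite -ler_pdivrMr//; apply: ub_le_sup.
  exists `|k| => _ [y /= y1 <-]; apply: le_trans (Tk y) _.
  apply: le_trans (_ : `|k| * `|y| <= _); last by rewrite ler_piMr.
  by rewrite ler_wpM2r// ler_norm.
exists (`|x|^-1 *: x) => /=.
  by rewrite normrZ normfV normr_id mulVf// gt_eqF.
by rewrite linearZ normrZ normfV normr_id mulrC.
Qed.

Lemma bounded_continuous {R : realType} (X Y : normedModType R)
    (T : {linear X -> Y}) (k : R) :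
  (forall x, `|T x| <= k * `|x|) -> continuous T.
Proof.
move=> Tk; apply/linear_bounded_continuous/bounded_funP => r.
exists (`|k| * `|r|) => x xr; apply: le_trans (Tk x) _.
apply: le_trans (_ : `|k| * `|x| <= _).
  by rewrite ler_wpM2r// ler_norm.
by rewrite ler_wpM2l// (le_trans xr)// ler_norm.
Qed.

(** |u| + |r| is the larger of |r + u| and |r - u|. *)
Lemma ler_norm_addsub {R : realType} (u r k : R) :
  `|r + u| <= k -> `|r - u| <= k -> `|u| + `|r| <= k.
Proof.
rewrite !ler_norml => /andP[? ?] /andP[? ?].
by case: (ger0P u) => ?; case: (ger0P r) => ?; lra.
Qed.

(** * The plane l_p^2: coordinates and bounded maps *)

Section plane.
Context {R : realType} (p : R) (p1 : 1 <= p).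
Implicit Types (x : lp2 p1) (f : {linear lp2 p1 -> R^o})
  (T : {linear lp2 p1 -> lp2 p1}).

Let p0 : 0 < p. Proof. exact: lt_le_trans p1. Qed.

Definition lp2_fst x : R := (x : 'cV[R]_2) 0 0.
Definition lp2_snd x : R := (x : 'cV[R]_2) 1 0.
Definition lp2_vec (a b : R) : lp2 p1 := \col_i (if i == 0 then a else b).

Lemma lp2_fst_vec a b : lp2_fst (lp2_vec a b) = a.
Proof. by rewrite /lp2_fst mxE. Qed.

Lemma lp2_snd_vec a b : lp2_snd (lp2_vec a b) = b.
Proof. by rewrite /lp2_snd mxE. Qed.

Lemma lp2_fstZ (k : R) x : lp2_fst (k *: x) = k * lp2_fst x.
Proof. by rewrite /lp2_fst !mxE. Qed.

Lemma lp2_fst_linear (k : R) x y :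
  lp2_fst (k *: x + y) = k * lp2_fst x + lp2_fst y.
Proof. by rewrite /lp2_fst !mxE. Qed.

Lemma lp2_sndZ (k : R) x : lp2_snd (k *: x) = k * lp2_snd x.
Proof. by rewrite /lp2_snd !mxE. Qed.

Lemma lp2_snd_linear (k : R) x y :
  lp2_snd (k *: x + y) = k * lp2_snd x + lp2_snd y.
Proof. by rewrite /lp2_snd !mxE. Qed.

Lemma lp2_vecE x :
  x = lp2_fst x *: lp2_vec 1 0 + lp2_snd x *: lp2_vec 0 1 :> lp2 p1.
Proof.
apply/matrixP => i j; rewrite (ord1 j) !mxE.
case: i => [[|[|//]]] i2 /=; rewrite !(mulr0, mulr1, addr0, add0r);
  congr (x _ _); exact: val_inj.
Qed.

Lemma lp2_norm_powR x : `|x| `^ p = `|lp2_fst x| `^ p + `|lp2_snd x| `^ p.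
Proof.
by rewrite lp2_normE /lp2_norm -powRrM mulVf ?gt_eqF// powRr1.
Qed.

Lemma ler_lp2 (a k : R) x : 0 <= a -> 0 <= k ->
  a `^ p <= k `^ p * (`|lp2_fst x| `^ p + `|lp2_snd x| `^ p) ->
  a <= k * `|x|.
Proof.
move=> a0 k0; rewrite -lp2_norm_powR -powRM//; apply: contraTT.
by rewrite -!ltNge => h; apply: gt0_ltr_powR; rewrite ?nnegrE ?mulr_ge0.
Qed.

(** Coordinates are bounded by the norm. Hence [operator_norm] is a genuine supremum for every
    linear map on the plane. *)
Lemma lp2_linear_bounded (Y : normedModType R) (T : {linear lp2 p1 -> Y}) :
  exists k, forall x, `|T x| <= k * `|x|.
Proof.
exists (`|T (lp2_vec 1 0)| + `|T (lp2_vec 0 1)|) => x.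
rewrite {1}(lp2_vecE x) linearD !linearZ /= mulrDl.
rewrite (le_trans (ler_normD _ _))// !normrZ lerD// mulrC ler_wpM2l//.
- exact: (ler_coord_lp2_norm p1 x 0).
- exact: (ler_coord_lp2_norm p1 x 1).
Qed.

Lemma lp2_operator_norm_ge (Y : normedModType R) (T : {linear lp2 p1 -> Y}) x :
  `|T x| <= operator_norm T * `|x|.
Proof. by have [k Tk] := lp2_linear_bounded T; exact: operator_norm_ge Tk x. Qed.

Lemma ler_numerical_radius T x f : continuous f -> `|x| = 1 ->
  operator_norm f = 1 -> f x = 1 -> `|f (T x)| <= numerical_radius T.
Proof.
move=> fc x1 f1 fx; apply: ub_le_sup; last by exists x, f.
exists (operator_norm T) => _ [y [h [_ y1 h1 _ ->]]].
apply: le_trans (lp2_operator_norm_ge h _) _.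
by rewrite h1 mul1r (le_trans (lp2_operator_norm_ge T _))// y1 mulr1.
Qed.

Lemma numerical_radius_ge0 T : 0 <= numerical_radius T.
Proof.
rewrite /numerical_radius; set S := (S in sup S).
have [[r Sr]|/set0P/negP/negPn/eqP->] := pselect (S !=set0); last by rewrite sup0.
case: (Sr) => x [f [fc x1 f1 fx rE]].
by rewrite (le_trans (normr_ge0 (f (T x))))//; exact: ler_numerical_radius.
Qed.

Definition lp2_form (u v : R) x : R^o := u * lp2_fst x + v * lp2_snd x.

Lemma lp2_form_is_linear (u v : R) : linear (lp2_form u v).
Proof.
move=> k x y; rewrite /lp2_form lp2_fst_linear lp2_snd_linear.
by rewrite /GRing.scale /=; ring.
Qed.

HB.instance Definition _ (u v : R) :=
  GRing.isLinear.Build R (lp2 p1) R^o _ (lp2_form u v) (lp2_form_is_linear u v).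

(** * Norming pairs and lower bounds for the numerical radius *)

(** The vector (X, sY) and the functional (X^(p-1), s Y^(p-1)) form a norming pair up to scaling:
    their norms are D = N^(1/p) and C = N^((p-1)/p), and their pairing is N = C D. *)
Lemma numerical_radius_pair T (X Y s : R) : 0 < X -> 0 < Y -> `|s| = 1 ->
  `|lp2_form (X `^ (p - 1)) (s * Y `^ (p - 1)) (T (lp2_vec X (s * Y)))| <=
  numerical_radius T * (X `^ p + Y `^ p).
Proof.
move=> X0 Y0 s1.
set N := X `^ p + Y `^ p.
have N0 : 0 < N by rewrite addr_gt0 ?powR_gt0.
pose D := N `^ p^-1; pose C := (N `^ (p - 1)) `^ p^-1.
have D0 : 0 < D by rewrite !powR_gt0.
have C0 : 0 < C by rewrite !powR_gt0.
have CDE : C * D = N.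
  rewrite -powRM ?powR_ge0 ?(ltW N0)// mulrC mulr_powRB1 ?(ltW N0)//.
  by rewrite -powRrM divff ?gt_eqF// powRr1// ltW.
have CpE : C `^ p = N `^ (p - 1).
  by rewrite -powRrM mulVf ?gt_eqF// powRr1// powR_ge0.
have ss : s * s = 1.
  by rewrite -[LHS]ger0_norm ?normrM ?s1 ?mulr1// -expr2 sqr_ge0.
set w := lp2_vec X (s * Y).
set u := X `^ (p - 1); set v := s * Y `^ (p - 1).
have fle y : `|lp2_form u v y| <= C * `|y|.
  apply: ler_lp2 => //; first exact: ltW.
  rewrite CpE /lp2_form.
  have v1 : `|v| = Y `^ (p - 1) by rewrite normrM s1 mul1r ger0_norm// powR_ge0.
  have u1 : `|u| = u by rewrite ger0_norm// powR_ge0.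
  have le_row : `|u| * X + `|v| * Y <= N.
    by rewrite u1 v1 [_ * X]mulrC mulr_powRB1 ?(ltW X0)// [_ * Y]mulrC mulr_powRB1 ?(ltW Y0).
  (* Taking [X], [Y] as weights and [N] as bound replaces Hölder's inequality, also for p = 1: the
     denominators cancel the coefficients of the functional. *)
  apply: le_trans (weighted_row_bound _ _ p1 X0 Y0 N0 le_row) _.
  by rewrite u1 v1 /u !mulrA ![_ * `|_| `^ p]mulrC !mulfK ?gt_eqF ?powR_gt0//
    ![`|_| `^ p / _ * _]mulrC.
have fw : lp2_form u v w = N.
  rewrite /lp2_form lp2_fst_vec lp2_snd_vec /u /v [_ * X]mulrC mulr_powRB1 ?(ltW X0)//.
  have -> : s * Y `^ (p - 1) * (s * Y) = (s * s) * (Y * Y `^ (p - 1)) by ring.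
  by rewrite ss mul1r mulr_powRB1 ?(ltW Y0).
pose x : lp2 p1 := D^-1 *: w.
have fE y : lp2_form (C^-1 * u) (C^-1 * v) y = C^-1 * lp2_form u v y.
  by rewrite /lp2_form; ring.
have gle y : `|lp2_form (C^-1 * u) (C^-1 * v) y| <= 1 * `|y|.
  rewrite fE normrM normfV (gtr0_norm C0) mul1r mulrC ler_pdivrMr//.
  by rewrite mulrC.
have gc : continuous (lp2_form (C^-1 * u) (C^-1 * v)).
  exact: bounded_continuous gle.
have gx : lp2_form (C^-1 * u) (C^-1 * v) x = 1.
  rewrite fE /x linearZ /= fw -CDE /GRing.scale /=.
  by field; rewrite !gt_eqF.
have wD : `|w| = D.
  rewrite lp2_normE /lp2_norm -/(lp2_fst w) -/(lp2_snd w).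
  by rewrite lp2_fst_vec lp2_snd_vec normrM s1 mul1r !gtr0_norm.
have x1 : `|x| = 1.
  by rewrite normrZ normfV (gtr0_norm D0) wD mulVf ?gt_eqF.
have g1 : operator_norm (lp2_form (C^-1 * u) (C^-1 * v)) = 1.
  apply/eqP; rewrite eq_le; apply/andP; split.
    exact: operator_norm_le ler01 gle.
  have : `|lp2_form (C^-1 * u) (C^-1 * v) x| <=
         operator_norm (lp2_form (C^-1 * u) (C^-1 * v)) * `|x|.
    exact: lp2_operator_norm_ge.
  by rewrite gx x1 mulr1 normr1.
have : `|lp2_form (C^-1 * u) (C^-1 * v) (T x)| <= numerical_radius T.
  exact: (ler_numerical_radius T gc x1 g1 gx).
rewrite fE /x !linearZ /= /GRing.scale /= mulrA -invfM CDE.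
by rewrite normrM normfV (gtr0_norm N0) mulrC ler_pdivrMr.
Qed.

(** Otherwise the test inequalities hold with a right-hand side below |P - t|. This leaves room to
    apply [contracts_polytope] to T / k for some k < 1, and then the norm of [T] is at most k. *)
Lemma numerical_radius_ge T (t : R) : operator_norm T = 1 -> 0 < t -> t < 1 ->
  `|t `^ (p - 1) - t| <= numerical_radius T * (1 + t `^ p).
Proof.
move=> T1 t0 t1; set P := t `^ (p - 1).
have [->|Pt] := eqVneq P t.
  by rewrite subrr normr0 mulr_ge0 ?numerical_radius_ge0// addr_ge0// powR_ge0.
have gE : t `^ p = P * t by rewrite mulrC mulr_powRB1// ltW.
rewrite leNgt; apply/negP; set K := numerical_radius T * _; set D := `|P - t| => KD.
pose a := lp2_fst (T (lp2_vec 1 0)); pose b := lp2_fst (T (lp2_vec 0 1)).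
pose c := lp2_snd (T (lp2_vec 1 0)); pose d := lp2_snd (T (lp2_vec 0 1)).
have Tfst x : lp2_fst (T x) = a * lp2_fst x + b * lp2_snd x.
  rewrite {1}(lp2_vecE x) linearD !linearZ /= lp2_fst_linear -/a.
  by rewrite lp2_fstZ -/b; ring.
have Tsnd x : lp2_snd (T x) = c * lp2_fst x + d * lp2_snd x.
  rewrite {1}(lp2_vecE x) linearD !linearZ /= lp2_snd_linear -/c.
  by rewrite lp2_sndZ -/d; ring.
have pair (X Y s : R) : 0 < X -> 0 < Y -> `|s| = 1 ->
    `|X `^ (p - 1) * (a * X + b * (s * Y)) +
      s * Y `^ (p - 1) * (c * X + d * (s * Y))| <=
    numerical_radius T * (X `^ p + Y `^ p).
  move=> X0 Y0 s1; have := numerical_radius_pair T X0 Y0 s1.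
  by rewrite /lp2_form Tfst Tsnd lp2_fst_vec lp2_snd_vec.
have N1 : `|- 1 : R| = 1 by rewrite normrN normr1.
(* The two signs of [s] give the sum and the difference of the parts even and odd in [s], as
   [ler_norm_addsub] requires. *)
have ur : `|b * t + c * P| + `|a + d * (P * t)| <= K.
  apply: ler_norm_addsub.
  - have := pair 1 t 1 ltr01 t0 (normr1 _); rewrite !powR1 -/P -/K.
    by congr (`|_| <= _); ring.
  - have := pair 1 t (-1) ltr01 t0 N1; rewrite !powR1 -/P -/K.
    by congr (`|_| <= _); ring.
have ws : `|b * P + c * t| + `|a * (P * t) + d| <= K.
  apply: ler_norm_addsub.
  - have := pair t 1 1 t0 ltr01 (normr1 _); rewrite !powR1 -/P addrC -/K.
    by rewrite [t `^ p + 1]addrC -/K; congr (`|_| <= _); ring.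
  - have := pair t 1 (-1) t0 ltr01 N1; rewrite !powR1 -/P.
    by rewrite [t `^ p + 1]addrC -/K; congr (`|_| <= _); ring.
have K0 : 0 <= K by rewrite mulr_ge0 ?numerical_radius_ge0// addr_ge0// powR_ge0.
have D0 : 0 < D by rewrite normr_gt0 subr_eq0.
(* The midpoint of K / D and 1, positive even when [K] is 0. *)
pose k := (K + D) / (D * 2).
have k0 : 0 < k by rewrite divr_gt0 ?mulr_gt0//; lra.
have k1 : k < 1 by rewrite /k ltr_pdivrMr ?mulr_gt0//; lra.
have KkD : K <= D * k.
  have -> : D * k = (K + D) / 2 by rewrite /k; field; rewrite gt_eqF.
  lra.
have scale (x y : R) : `|x| + `|y| <= K -> `|x / k| + `|y / k| <= D.
  move=> xy; rewrite !normrM normfV (gtr0_norm k0) -mulrDl ler_pdivrMr//.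
  exact: le_trans KkD.
have A : contracts p (a / k) (b / k) (c / k) (d / k).
  apply: (contracts_polytope p1 t0 t1 Pt).
  - have := scale _ _ ur.
    have -> : (b * t + c * P) / k = b / k * t + c / k * P by ring.
    by have -> : (a + d * (P * t)) / k = a / k + d / k * (P * t) by ring.
  - have := scale _ _ ws.
    have -> : (b * P + c * t) / k = b / k * P + c / k * t by ring.
    by have -> : (a * (P * t) + d) / k = a / k * (P * t) + d / k by ring.
have Tk x : `|T x| <= k * `|x|.
  rewrite mulrC -ler_pdivrMr// -[leRHS]mul1r; apply: ler_lp2 => //.
    by rewrite divr_ge0// ltW.
  rewrite powR1 mul1r powRM ?invr_ge0 ?(ltW k0)// lp2_norm_powR mulrDl.
  rewrite -!powRM ?invr_ge0 ?(ltW k0)//.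
  have nk (z : R) : `|z| / k = `|z / k| by rewrite normrM normfV (gtr0_norm k0).
  rewrite !nk; have := A (lp2_fst x) (lp2_snd x).
  have -> : a / k * lp2_fst x + b / k * lp2_snd x = lp2_fst (T x) / k.
    by rewrite Tfst; ring.
  have -> : c / k * lp2_fst x + d / k * lp2_snd x = lp2_snd (T x) / k.
    by rewrite Tsnd; ring.
  by [].
by have := operator_norm_le (ltW k0) Tk; rewrite T1 leNgt k1.
Qed.

End plane.

(** * The rotation and its norming pairs *)

(** The equations say u = sg(a) |a|^(p-1) and likewise for [v], so both expressions agree up to the
    sign sg(a) sg(b), written below as b / a * (|a| / |b|). *)
Lemma norm_wedge_gradient {R : realType} (p a b u v : R) : 0 < p ->
  a != 0 -> b != 0 -> a * u = `|a| `^ p -> b * v = `|b| `^ p ->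
  `|b * u - a * v| = `| `|a| `^ (p - 1) * `|b| - `|b| `^ (p - 1) * `|a| |.
Proof.
move=> p0 a_neq0 b_neq0 au bv.
have A0 : 0 < `|a| by rewrite normr_gt0.
have B0 : 0 < `|b| by rewrite normr_gt0.
have uE : u = `|a| * `|a| `^ (p - 1) / a.
  by rewrite mulr_powRB1// -au; field.
have vE : v = `|b| * `|b| `^ (p - 1) / b.
  by rewrite mulr_powRB1// -bv; field.
have unit_norm : `|b / a * (`|a| / `|b|)| = 1.
  by rewrite !normrM !normfV !normr_id; field; rewrite !gt_eqF.
have -> : b * u - a * v = b / a * (`|a| / `|b|) *
    (`|a| `^ (p - 1) * `|b| - `|b| `^ (p - 1) * `|a|).
  have sqa : a ^+ 2 = `|a| ^+ 2 by rewrite real_normK ?num_real.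
  have sqb : b ^+ 2 = `|b| ^+ 2 by rewrite real_normK ?num_real.
  have -> : v = `|b| `^ (p - 1) * b / `|b|.
    have -> : `|b| `^ (p - 1) * b / `|b| = b ^+ 2 * `|b| `^ (p - 1) / (b * `|b|).
      by field; rewrite b_neq0 gt_eqF.
    by rewrite sqb vE; field; rewrite b_neq0 gt_eqF.
  rewrite uE; apply: (mulIf a_neq0).
  have -> : a * (`|b| `^ (p - 1) * b / `|b|) =
    a ^+ 2 * (`|b| `^ (p - 1) * b / `|b| / a) by field; rewrite a_neq0 gt_eqF.
  by rewrite sqa; field; rewrite a_neq0 gt_eqF.
by rewrite normrM unit_norm mul1r.
Qed.

Section rotation.
Context {R : realType} (p : R) (p1 : 1 <= p).
Implicit Types (x : lp2 p1) (f : {linear lp2 p1 -> R^o})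
  (T : {linear lp2 p1 -> lp2 p1}).

Let J := lp2_operator p1 (matJ R).

Lemma matJE x : J x = lp2_vec p1 (lp2_snd x) (- lp2_fst x).
Proof.
apply/matrixP => i j; rewrite (ord1 j) !mxE !big_ord_recr big_ord0 /= !mxE.
have -> : widen_ord (leqnSn 1) ord_max = 0 :> 'I_2 by exact: val_inj.
have -> : ord_max = 1 :> 'I_2 by exact: val_inj.
rewrite /lp2_fst /lp2_snd.
by case: i => [[|[|//]]] i2 /=; ring.
Qed.

Lemma normJ x : `|J x| = `|x|.
Proof.
rewrite !lp2_normE /lp2_norm; congr (_ `^ _).
rewrite -!/(lp2_fst _) -!/(lp2_snd _) matJE lp2_fst_vec lp2_snd_vec normrN.
by rewrite addrC.
Qed.

Lemma operator_normJ : continuous J /\ operator_norm J = 1.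
Proof.
have Jle x : `|J x| <= 1 * `|x| by rewrite normJ mul1r.
split; first exact: bounded_continuous Jle.
apply/eqP; rewrite eq_le; apply/andP; split.
  exact: operator_norm_le ler01 Jle.
have v1 : `|lp2_vec p1 1 0| = 1.
  have p0 : p != 0 by rewrite gt_eqF// (lt_le_trans ltr01).
  rewrite lp2_normE /lp2_norm -/(lp2_fst _) -/(lp2_snd _).
  by rewrite lp2_fst_vec lp2_snd_vec normr1 normr0 powR0// powR1 addr0 powR1.
have : `|J (lp2_vec p1 1 0)| <= operator_norm J * `|lp2_vec p1 1 0|.
  exact: lp2_operator_norm_ge.
by rewrite normJ v1 mulr1.
Qed.

Lemma lp2_functionalE f x : f x =
  lp2_fst x * f (lp2_vec p1 1 0) + lp2_snd x * f (lp2_vec p1 0 1) :> R.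
Proof. by rewrite {1}(lp2_vecE x) linearD !linearZ. Qed.

(* Smoothness of the sphere for [p > 1]; it fails for [p = 1]. *)
Lemma norming_form x f : 1 < p -> `|x| = 1 -> operator_norm f = 1 -> f x = 1 ->
  [/\ lp2_fst x * f (lp2_vec p1 1 0) = `|lp2_fst x| `^ p,
      lp2_snd x * f (lp2_vec p1 0 1) = `|lp2_snd x| `^ p,
      lp2_fst x = 0 -> f (lp2_vec p1 1 0) = 0 &
      lp2_snd x = 0 -> f (lp2_vec p1 0 1) = 0].
Proof.
move=> gt1 x1 f1 fx.
have x1p : `|lp2_fst x| `^ p + `|lp2_snd x| `^ p = 1.
  by rewrite -lp2_norm_powR x1 powR1.
(* Bernoulli's inequality at |f y| makes 1 + p (f y - 1) an affine minorant of ||y||^p. Both equal 1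
   at [x], so varying one coordinate of [x] yields a subgradient of |.|^p. *)
have ub y : 1 + p * (f y - 1) <= `|lp2_fst y| `^ p + `|lp2_snd y| `^ p.
  have fy : `|f y| <= `|y|.
    by have := lp2_operator_norm_ge f y; rewrite f1 mul1r.
  rewrite -lp2_norm_powR.
  apply: (@le_trans _ _ (`|f y : R| `^ p)).
    apply: le_trans (powR_bernoulli p1 (normr_ge0 _)).
    by rewrite lerD2l ler_pM2l ?(lt_le_trans ltr01)// lerD2r ler_norm.
  by apply: ge0_ler_powR; rewrite ?nnegrE// (le_trans ler01).
move: fx; rewrite lp2_functionalE => fx.
have grad1 s : p * (s * f (lp2_vec p1 1 0)) + `|lp2_fst x| `^ p <=
    `|lp2_fst x + s| `^ p.
  have := ub (lp2_vec p1 (lp2_fst x + s) (lp2_snd x)).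
  rewrite lp2_functionalE lp2_fst_vec lp2_snd_vec.
  have -> : (lp2_fst x + s) * f (lp2_vec p1 1 0) +
     lp2_snd x * f (lp2_vec p1 0 1) =
     lp2_fst x * f (lp2_vec p1 1 0) + lp2_snd x * f (lp2_vec p1 0 1) +
     s * f (lp2_vec p1 1 0) by ring.
  rewrite fx.
  by move: x1p; lra.
have [g1 z1] := subgradient_norm_powR gt1 grad1.
have grad2 s : p * (s * f (lp2_vec p1 0 1)) + `|lp2_snd x| `^ p <=
    `|lp2_snd x + s| `^ p.
  have := ub (lp2_vec p1 (lp2_fst x) (lp2_snd x + s)).
  rewrite lp2_functionalE lp2_fst_vec lp2_snd_vec.
  have -> : lp2_fst x * f (lp2_vec p1 1 0) +
     (lp2_snd x + s) * f (lp2_vec p1 0 1) =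
     lp2_fst x * f (lp2_vec p1 1 0) + lp2_snd x * f (lp2_vec p1 0 1) +
     s * f (lp2_vec p1 0 1) by ring.
  rewrite fx.
  by move: x1p; lra.
have [g2 z2] := subgradient_norm_powR gt1 grad2.
(* The inequalities [g1] and [g2] are equalities: their left sides add up to f x = 1 and their right
   sides to ||x||^p = 1. *)
by split=> //; lra.
Qed.

(** By symmetry Y < X may be assumed. This is then [numerical_radius_ge] at t = Y / X multiplied by
    X^p, since X^p (1 + t^p) = 1. *)
Lemma numerical_radius_ge_coord T (X Y : R) : operator_norm T = 1 ->
  0 < X -> 0 < Y -> X `^ p + Y `^ p = 1 ->
  `|X `^ (p - 1) * Y - Y `^ (p - 1) * X| <= numerical_radius T.
Proof.
move=> T1; wlog: X Y / Y <= X.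
  move=> h X0 Y0 XY; have [|/ltW] := leP Y X; first by move=> /h; exact.
  by move=> /h; rewrite distrC; apply => //; rewrite addrC.
rewrite le_eqVlt => /predU1P[-> _ _ _|YX X0 Y0 XY].
  by rewrite subrr normr0 numerical_radius_ge0.
have p0 : 0 < p by rewrite (lt_le_trans ltr01).
have t0 : 0 < Y / X by rewrite divr_gt0.
have t1 : Y / X < 1 by rewrite ltr_pdivrMr// mul1r.
have quot r : (Y / X) `^ r = Y `^ r / X `^ r.
  rewrite powRM ?invr_ge0 ?(ltW X0) ?(ltW Y0)//.
  by rewrite -(powR_inv1 (ltW X0)) -powRrM mulN1r powRN.
have Xp : 0 < X `^ p by rewrite powR_gt0.
have := ler_wpM2r (ltW Xp) (numerical_radius_ge T1 t0 t1).
rewrite -mulrA mulrDl mul1r !quot divfK ?gt_eqF// XY mulr1.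
rewrite -{1}(gtr0_norm Xp) -normrM -{1}(mulr_powRB1 (ltW X0) p0).
have Xq : X `^ (p - 1) != 0 by rewrite gt_eqF// powR_gt0.
have -> : (Y `^ (p - 1) / X `^ (p - 1) - Y / X) * (X * X `^ (p - 1)) =
   Y `^ (p - 1) * X - X `^ (p - 1) * Y.
  by field; rewrite Xq gt_eqF.
by rewrite distrC.
Qed.

(** For p > 1 the point [x] determines [f], so |f (J x)| is the quantity bounded in
    [numerical_radius_ge_coord], or 0 when [x] lies on an axis. *)
Lemma norming_form_J_le T x f : 1 < p -> operator_norm T = 1 -> `|x| = 1 ->
  operator_norm f = 1 -> f x = 1 -> `|f (J x)| <= numerical_radius T.
Proof.
move=> gt1 T1 x1 f1 fx.
have x1p : `|lp2_fst x| `^ p + `|lp2_snd x| `^ p = 1.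
  by rewrite -lp2_norm_powR x1 powR1.
have [] := norming_form gt1 x1 f1 fx.
have -> : f (J x) = lp2_snd x * f (lp2_vec p1 1 0) -
    lp2_fst x * f (lp2_vec p1 0 1) :> R.
  by rewrite lp2_functionalE matJE lp2_fst_vec lp2_snd_vec mulNr.
move: (lp2_fst x) (lp2_snd x) (f _ : R) (f _ : R) x1p => a b u v ab au bv a0 b0.
have [a_eq0|a_neq0] := eqVneq a 0.
  by rewrite a_eq0 a0// mul0r mulr0 subrr normr0 numerical_radius_ge0.
have [b_eq0|b_neq0] := eqVneq b 0.
  by rewrite b_eq0 b0// mul0r mulr0 subrr normr0 numerical_radius_ge0.
have p0 : 0 < p by rewrite (lt_le_trans ltr01).
rewrite (norm_wedge_gradient p0 a_neq0 b_neq0 au bv).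
by apply: numerical_radius_ge_coord; rewrite ?normr_gt0.
Qed.

Lemma numerical_radius_J_ubound x f T : operator_norm T = 1 -> continuous f ->
  `|x| = 1 -> operator_norm f = 1 -> f x = 1 -> `|f (J x)| <= numerical_radius T.
Proof.
move=> T1 fc x1 f1 fx.
have [gt1|le1] := ltP 1 p; first exact: norming_form_J_le.
have pE : p = 1 by apply/eqP; rewrite eq_le le1.
(* For p = 1 the comparison goes through 1: |f (J x)| <= 1 because [J] is an isometry, and small [t]
   in [numerical_radius_ge] forces the numerical radius of [T] to be at least 1. *)
apply: (@le_trans _ _ 1).
  have := lp2_operator_norm_ge f (J x).
  by rewrite f1 mul1r normJ x1.
apply/ler_addgt0Pr => e e0; rewrite leNgt; apply/negP => h.
have M0 := numerical_radius_ge0 T.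
(* If v(T) < 1 - e, this [t] contradicts 1 - t <= v(T) (1 + t), as (1 - e)(1 + e/2) < 1 - e/2. *)
pose t := e / 2.
have t0 : 0 < t by rewrite divr_gt0.
have t1 : t < 1 by rewrite /t; lra.
have := numerical_radius_ge T1 t0 t1.
move: (numerical_radius T) h M0 => M h M0.
rewrite pE subrr powRr0 powRr1 ?(ltW t0)// ger0_norm; last lra.
rewrite /t; nra.
Qed.

End rotation.

Theorem theorem1p1 (R : realType) (p : R) (p1 : 1 <= p) :
  numerical_index (lp2 p1) = numerical_radius (lp2_operator p1 (matJ R)).

Proof.
have [Jc J1] := operator_normJ p1.
rewrite /numerical_index; set S := (S in inf S).
have SJ : S (numerical_radius (lp2_operator p1 (matJ R))).
  by exists (lp2_operator p1 (matJ R)).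
apply/eqP; rewrite eq_le; apply/andP; split.
  apply: ge_inf SJ; exists 0 => _ [T _ <-]; exact: numerical_radius_ge0.
apply: lb_le_inf; first by exists (numerical_radius (lp2_operator p1 (matJ R))).
move=> _ [T [_ T1] <-]; rewrite {1}/numerical_radius; set V := (V in sup V).
(* The supremum of the empty set is 0 by convention, so that case follows from nonnegativity. *)
have [V0|/set0P/negP/negPn/eqP->] := pselect (V !=set0); last first.
  by rewrite sup0 numerical_radius_ge0.
apply: ge_sup => // _ [x [f [fc x1 f1 fx ->]]].
exact: numerical_radius_J_ubound.
Qed.
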